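(* Let $(X,Y,c=\langle\cdot,\cdot\rangle)$ be a dual system and let $K\subset X$ be a nonempty convex set. Let $f:K\to Y$, and let $T:X\rightrightarrows Y$ be a monotone multivalued operator with non-empty graph such that $D(T)\subset K$. Let $\beta$ be a linear Hausdorff topology on $\operatorname{lin}K$ such that $(K,\beta)$ is compact. Assume that, for every $z\in\operatorname{Graph}T$, the function $$f_{z}:K\to\mathbb{R},\qquad f_{z}(x):=c(z-(x,f(x)))$$ is $\beta$-upper semicontinuous, i.e. whenever $\{x_i\}_{i\in I}\subset K$ is a net with $x_i\overset{\beta}{\to}x_0$, one has $c(z-(x_0,f(x_0)))\ge\limsup_{i\in I}c(z-(x_i,f(x_i)))$. Then $\operatorname{Graph}(T^{+})\cap\operatorname{Graph}(f)\neq\emptyset$; equivalently, there exists $x\in K$ such that $(x,f(x))$ is monotonically related to $T$, that is, $f(x)\in T^{+}(x)$.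
   Context: A dual system $(X,Y,c=\langle\cdot,\cdot\rangle)$ consists of real vector spaces $X,Y$ and a bilinear form $\langle\cdot,\cdot\rangle:X\times Y\to\mathbb{R}$; no separation is assumed. $c(x,y):=\langle x,y\rangle$. For a multivalued operator $T:X\rightrightarrows Y$, $\operatorname{Graph}T=\{(x,y)\mid y\in T(x)\}$ and $D(T)=\{x\mid T(x)\ne\emptyset\}$. $T$ is monotone if $c(z_1-z_2)\ge0$ for all $z_1,z_2\in\operatorname{Graph}T$. $T^{+}:X\rightrightarrows Y$ is defined by $\operatorname{Graph}(T^{+})=\{z\in X\times Y\mid c(z-w)\ge0\ \forall w\in\operatorname{Graph}T\}$, the set of points monotonically related to $T$. $\operatorname{lin}K$ is the linear span of $K$ in $X$; a linear topology is a vector space topology (not necessarily locally convex); $K$ carries the trace of $\beta$. *)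

(* Defs.v *)
From HB Require Import structures.
From mathcomp Require Import all_boot all_order all_algebra sesquilinear.
From mathcomp Require Import all_classical all_reals all_analysis.

Set Implicit Arguments.
Unset Strict Implicit.
Unset Printing Implicit Defensive.

Import Order.TTheory GRing.Theory Num.Theory.
Import numFieldNormedType.Exports.

Local Open Scope classical_set_scope.
Local Open Scope ring_scope.

Section MultivaluedOperators.
Context (R : realType) (X Y : lmodType R) (c : X -> Y -> R).
Implicit Types T : X -> set Y.

Definition coupling (z : X * Y) : R := c z.1 z.2.

Definition op_graph T : set (X * Y) := [set z | T z.1 z.2].

Definition op_dom T : set X := [set x | T x !=set0].

Definition op_monotone T : Prop :=
  forall z1 z2, op_graph T z1 -> op_graph T z2 -> 0 <= coupling (z1 - z2).

(* T^+, the points monotonically related to T. *)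
Definition op_polar T : X -> set Y :=
  fun x => [set y | forall w, op_graph T w -> 0 <= coupling ((x, y) - w)].

Definition fun_graph (K : set X) (f : K -> Y) : set (X * Y) :=
  range (fun x : K => (val x, f x)).

End MultivaluedOperators.

Section LinearSpan.
Context (R : realType) (X : lmodType R) (K : set X).

Definition span_pred : {pred X} :=
  fun x => x \in smallest (fun M : set X => submod_closed [in M]) K.

Lemma span_submod_closed : submod_closed span_pred.
Proof.
split=> [|a u v]; first by apply/mem_set => M [[M0 _] _]; exact: set_mem.
move=> /set_mem Su /set_mem Sv; apply/mem_set => M MP.
by apply: set_mem; apply: MP.1.2; apply: mem_set; [exact: Su|exact: Sv].
Qed.

HB.instance Definition _ :=
  GRing.isSubmodClosed.Build R X span_pred span_submod_closed.

Record lin_span : Type := Lin { lin_val : X; _ : span_pred lin_val }.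

HB.instance Definition _ := [isSub for lin_val].
HB.instance Definition _ := [Choice of lin_span by <:].
HB.instance Definition _ := [SubChoice_isSubLmodule of lin_span by <:].

Lemma mem_span (x : K) : span_pred (val x).
Proof. apply/mem_set; apply: sub_gen_smallest; exact: set_valP. Qed.

Definition to_lin (x : K) : lin_span := Lin (mem_span x).

End LinearSpan.

(* [beta : topology_on V] is a system of open sets on a space that carries no
   canonical topology; [with_topology beta] is [V] equipped with it. *)
Definition topology_on (R : realType) (V : lmodType R) : Type :=
  isOpenTopological V.

Definition with_topology (R : realType) (V : lmodType R)
  (beta : topology_on V) : Type := V.

Section WithTopology.
Context (R : realType) (V : lmodType R) (beta : topology_on V).

HB.instance Definition _ := GRing.Lmodule.copy (with_topology beta) V.
HB.instance Definition _ : isOpenTopological (with_topology beta) := beta.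

(* These are the axioms of [topologicalLmodType]; [tvsType] would add local
   convexity. *)
Definition is_linear_topology : Prop :=
  continuous (fun z : with_topology beta * with_topology beta => z.1 + z.2) /\
  continuous (fun z : R^o * with_topology beta => z.1 *: z.2).

End WithTopology.

Definition trace_topology (R : realType) (X : lmodType R) (K : set X)
    (beta : topology_on (lin_span K)) : Type :=
  initial_topology (fun x : K => to_lin x : with_topology beta).

HB.instance Definition _ (R : realType) (X : lmodType R) (K : set X)
    (beta : topology_on (lin_span K)) :=
  Topological.copy (trace_topology beta)
    (initial_topology (fun x : K => to_lin x : with_topology beta)).

Definition directed_rel (I : Type) (le : I -> I -> Prop) : Prop :=
  [/\ inhabited I, forall i, le i i,
      forall i j k, le i j -> le j k -> le i k &
      forall i j, exists2 k, le i k & le j k].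

Definition net_cvg (S : topologicalType) (I : Type) (le : I -> I -> Prop)
    (x : I -> S) (x0 : S) : Prop :=
  forall U, nbhs x0 U -> exists i, forall j, le i j -> U (x j).

Definition net_limsup (R : realType) (I : Type) (le : I -> I -> Prop)
    (u : I -> R) : \bar R :=
  ereal_inf (range (fun i => ereal_sup [set (u j)%:E | j in le i])).

Definition upper_semicontinuous (R : realType) (S : topologicalType)
    (g : S -> R) : Prop :=
  forall (I : Type) (le : I -> I -> Prop) (x : I -> S) (x0 : S),
    directed_rel le -> net_cvg le x x0 ->
    (net_limsup le (g \o x) <= (g x0)%:E)%E.

(* Main.v *)
(** For z in Graph T the set {x in K | f_z x >= 0} is closed in the compact K,
    so it suffices to intersect finitely many of them, for z_1, ..., z_n.  Pull
    them back to the standard simplex along the barycentric map of the first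
    components x_i.  If f_{z_i} x < 0 at x = \sum a_i x_i for every i with
    a_i > 0, then \sum a_i f_{z_i} x < 0; but this sum equals
    1/2 \sum a_i a_j <x_i - x_j, y_i - y_j>, which is nonnegative by
    monotonicity.  This is the covering condition of the KKM lemma, which
    yields a common point.  KKM is obtained from Scarf's combinatorial lemma on
    dominant sets for several linear orders, applied to finer and finer grids
    of the simplex; no triangulation is needed. *)

Require Import Defs.
From mathcomp Require Import all_boot zify.

Set Implicit Arguments.
Unset Strict Implicit.
Unset Printing Implicit Defensive.


(** Scarf's notion: no point is strictly above the minimum of [S] in all the orders [r i] at
    once. *)
Definition dominant (V N : finType) (r : N -> V -> nat) (S : {set V}) :=
  [forall x, exists i, forall y in S, r i x <= r i y].

(** * Scarf's lemma *)

Section Scarf.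
(** The [e i] are artificial points that close up the configuration like the facets of a simplex;
    because of them the parity count has a single boundary term. *)
Variables (V N : finType) (r : N -> V -> nat) (e : N -> V) (c : V -> N).
Hypothesis r_inj : forall i, injective (r i).
Hypothesis e_min : forall i x, r i (e i) <= r i x.
Hypothesis e_max : forall i j x, (forall k, x != e k) -> j != i -> r i x < r i (e j).
Hypothesis ce : forall i, c (e i) = i.
Implicit Types (S D : {set V}) (x y : V).

Lemma dominantP S :
  reflect (forall x, exists i, forall y, y \in S -> r i x <= r i y)
          (dominant r S).
Proof.
apply: (iffP forallP) => [h x|h x].
  by have /existsP[i /forall_inP hi] := h x; exists i.
by have [i hi] := h x; apply/existsP; exists i; apply/forall_inP.
Qed.

(** If some removal qualifies, [S] misses only the colour [i0], so exactly two of its points share a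
    colour, and these two are the possible removals. *)
Lemma card_removals_even i0 S : #|S| = #|N| -> c @: S != setT ->
  ~~ odd #|[set x in S | c @: (S :\ x) == [set~ i0]]|.
Proof.
move=> cS cSN.
have [->|/set0Pn[x]] := eqVneq [set x in S | c @: (S :\ x) == [set~ i0]] set0.
  by rewrite cards0.
rewrite inE => /andP[xS /eqP hx].
have cSx : #|S :\ x| = #|N|.-1 by rewrite -cS (cardsD1 x S) xS.
have c_inj : {in S :\ x &, injective c}.
  by apply/imset_injP; rewrite hx cardsC1 cSx.
have cx : c x != i0.
  apply: contra cSN => /eqP cx; apply/eqP/setP => k; rewrite inE.
  have [->|ki] := eqVneq k i0; first by rewrite -cx imset_f.
  have : k \in c @: (S :\ x) by rewrite hx !inE.
  by apply: subsetP; apply: imsetS; rewrite subsetDl.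
have : c x \in c @: (S :\ x) by rewrite hx !inE.
case/imsetP=> y ySx cxy; have /[!inE]/andP[yx yS] := ySx.
suff -> : [set x in S | c @: (S :\ x) == [set~ i0]] = [set x; y].
  by rewrite cards2 eq_sym yx.
apply/setP => z; rewrite !inE; apply/andP/orP => [[zS /eqP hz]|]; last first.
  case=> /eqP->; first by rewrite xS hx.
  split=> //; rewrite -hx; apply/eqP/setP => k; apply/imsetP/imsetP => -[w].
    rewrite !inE => /andP[wy wS] ->; have [->|wx] := eqVneq w x.
      by exists y => //; rewrite !inE yx.
    by exists w => //; rewrite !inE wx.
  rewrite !inE => /andP[wx wS] ->; have [->|wy] := eqVneq w y.
    by exists x => //; rewrite !inE eq_sym yx.
  by exists w => //; rewrite !inE wy.
have [->|zx] := eqVneq z x; first by left.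
right; apply/eqP.
have zSx : z \in S :\ x by rewrite !inE zx.
have : c z \in c @: (S :\ z) by rewrite hz -hx imset_f.
case/imsetP=> w /[!inE]/andP[wz wS] czw.
have [wx|wx] := eqVneq w x.
  by apply: c_inj => //; rewrite czw wx.
by case/eqP: wz; apply/esym/c_inj => //; rewrite !inE wx.
Qed.

(** Pivoting. If a dominant extension exists, every point of [D] is the minimum of [D] in some
    order. As [D] has one point fewer than there are orders, exactly two orders [i] and [j] share
    their minimum. The new point takes over one of them, [k], and must then be the [r k]-largest
    point above the minima of [D] in all other orders: this leaves [a i] and [a j], which differ. *)
Lemma card_extensions_even i0 D : c @: D = [set~ i0] -> #|D|.+1 = #|N| ->
    D != e @: [set~ i0] ->
  ~~ odd #|[set x in ~: D | dominant r (x |: D)]|.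
Proof.
move=> cD cardD DD0.
have [->|/set0Pn[x0]] := eqVneq [set x in ~: D | dominant r (x |: D)] set0.
  by rewrite cards0.
rewrite inE => /andP[_ /dominantP dx0].
have domD x : exists i, forall y, y \in D -> r i x <= r i y.
  by have [i hi] := dx0 x; exists i => y yD; apply: hi; rewrite !inE yD orbT.
(* Only the outer door consists of artificial points alone. The ordinary point [d] makes [M k (e k)]
   true below, so that [a k] is a maximum over a nonempty set. *)
have [d dD de] : exists2 d, d \in D & forall k, d != e k.
  have [/existsP[d /andP[dD /forallP]]|] :=
    boolP [exists d in D, forall k, d != e k]; first by exists d.
  rewrite negb_exists => /forallP h.
  have De y : y \in D -> y = e (c y).
    move=> yD; have := h y; rewrite yD /= negb_forall => /existsP[k].
    by rewrite negbK => /eqP ->; rewrite ce.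
  case/eqP: DD0; rewrite -cD -imset_comp; apply/setP => y.
  apply/idP/imsetP => [yD|[z zD /= ->]]; first by exists y => //=; exact: De.
  by rewrite -De.
pose m i := [arg min_(y < d in D) r i y].
have mD i : m i \in D by rewrite /m; case: arg_minnP.
have mle i y : y \in D -> r i (m i) <= r i y.
  by rewrite /m; case: arg_minnP => // z _; apply.
have mP i y : y \in D -> (forall z, z \in D -> r i y <= r i z) -> y = m i.
  by move=> yD h; apply: (@r_inj i); apply/anti_leq; rewrite h //= mle.
have mlt i x : x \notin D -> r i (m i) <= r i x -> r i (m i) < r i x.
  move=> xD; rewrite leq_eqVlt => /predU1P[/r_inj E|//].
  by rewrite -E mD in xD.
have m_sur y : y \in D -> exists i, y = m i.
  by move=> yD; have [i hi] := domD y; exists i; apply: mP.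
have [i [j [ij mij]]] : exists i j, i != j /\ m i = m j.
  have [/injectiveP m_inj|] := boolP (injectiveb m); last first.
    by case/injectivePn => i [j ij E]; exists i, j.
  have : #|m @: setT| <= #|D|.
    by apply/subset_leq_card/subsetP => _ /imsetP[k _ ->].
  by rewrite card_imset // cardsT -cardD ltnn.
(* Off [k], [m] still maps onto [D], and the two cardinals agree. *)
have m_inj k k' : k != k' -> m k = m k' ->
    forall l l', l != k -> l' != k -> m l = m l' -> l = l'.
  move=> kk' mkk' l l' lk l'k.
  suff /imset_injP mi : #|m @: ~: [set k]| == #|~: [set k]|.
    by apply: mi; rewrite !inE.
  rewrite cardsC1 -cardD /=; apply/eqP/eq_card => y.
  apply/imsetP/idP => [[q _ ->]//|/m_sur[q ->]].
  have [->|qk] := eqVneq q k; last by exists q => //; rewrite !inE.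
  by exists k' => //; rewrite !inE eq_sym.
pose M k x := [forall (l | l != k), r l (m l) < r l x].
have Me k : M k (e k).
  apply/forall_inP => l lk; apply: (leq_ltn_trans (mle l d dD)).
  by apply: e_max; rewrite // eq_sym.
pose a k := [arg max_(x > e k | M k x) r k x].
have aM k : M k (a k) by rewrite /a; case: arg_maxnP; rewrite ?Me.
have amax k x : M k x -> r k x <= r k (a k).
  by rewrite /a; case: arg_maxnP; rewrite ?Me // => y _; apply.
have alt k k' : k != k' -> m k = m k' -> r k (a k) < r k (m k).
  move=> kk' mkk'; have [l hl] := domD (a k).
  have lk : l = k.
    apply/eqP/negP => /negP lk; have /forall_inP/(_ l lk) := aM k.
    by rewrite ltnNge hl.
  subst l; rewrite ltn_neqAle hl // andbT; apply/eqP => /r_inj E.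
  have /forall_inP/(_ k') := aM k.
  by rewrite E mkk' ltnn eq_sym; move/(_ kk').
have adom k k' : k != k' -> m k = m k' ->
    (a k \notin D) && dominant r (a k |: D).
  move=> kk' mkk'; have altk := alt _ _ kk' mkk'; apply/andP; split.
    by apply: contraL altk => aD; rewrite -leqNgt mle.
  apply/dominantP => x; have [xM|] := boolP (M k x).
    exists k => y /setU1P[->|yD]; first exact: amax.
    by rewrite (leq_trans (amax _ _ xM)) // (leq_trans (ltnW altk)) // mle.
  rewrite negb_forall => /existsP[l]; rewrite negb_imply -leqNgt => /andP[lk xl].
  exists l => y /setU1P[->|yD]; last by rewrite (leq_trans xl) // mle.
  by rewrite (leq_trans xl) // ltnW //; have /forall_inP := aM k; apply.
suff -> : [set x in ~: D | dominant r (x |: D)] = [set a i; a j].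
  rewrite cards2; suff -> : a i != a j by [].
  apply/eqP => E; have := alt _ _ ij mij; rewrite E.
  by have /forall_inP/(_ i ij) := aM j => /ltnW; rewrite leqNgt => /negbTE->.
apply/setP => x; rewrite !inE; apply/idP/orP => [|[]/eqP->]; last 2 first.
- exact: adom ij mij.
- by apply: (adom j i); rewrite // eq_sym.
case/andP=> xD /dominantP dx.
(* In the order [k], [x] lies below all of [D]. Every point of [D] is then the minimum of [D] in
   some order other than [k], so [m k] is a repeated minimum and [k] is [i] or [j]. *)
have [k hk] := dx x.
have xlt y : y \in D -> r k x < r k y.
  move=> yD; rewrite ltn_neqAle hk ?inE ?yD ?orbT// andbT.
  by apply/eqP => /r_inj E; rewrite E yD in xD.
have step y : y \in D -> exists l, [/\ l != k, y = m l & r l y < r l x].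
  move=> yD; have [l hl] := dx y; exists l.
  have lx : r l y <= r l x by apply: hl; rewrite !inE eqxx.
  have yl : y = m l by apply: mP => // z zD; apply: hl; rewrite !inE zD orbT.
  split=> //; last by rewrite yl mlt // -yl.
  by apply/eqP => E; move: lx; rewrite E leqNgt xlt.
have [k' [k'k mkk' _]] := step _ (mD k).
have kk' : k != k' by rewrite eq_sym.
have kij : (k == i) || (k == j).
  apply/norP => -[ki kj].
  have ji : j != i by rewrite eq_sym.
  have k'i : k' = i.
    apply/eqP/negP => /negP k'i; case/eqP: kk'.
    exact: (m_inj i j ij mij).
  have k'j : k' = j.
    apply/eqP/negP => /negP k'j; case/eqP: kk'.
    exact: (m_inj j i ji (esym mij)).
  by case/eqP: ij; rewrite -k'i -k'j.
have xM : M k x.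
  apply/forall_inP => l lk; have [l' [l'k ml' lt']] := step _ (mD l).
  by rewrite {1 3}(m_inj k k' kk' mkk' l l' lk l'k ml').
have xa : x = a k.
  apply: (@r_inj k); apply/anti_leq; rewrite amax //=.
  have [l hl] := dx (a k).
  have lk : l = k.
    apply/eqP/negP => /negP lk; have /forall_inP/(_ l lk) := aM k.
    by rewrite ltnNge hl // !inE mD orbT.
  by rewrite -lk in hl *; apply: hl; rewrite !inE eqxx.
by rewrite xa; case/orP: kij => /eqP->; [left|right].
Qed.

(** For [l != i0] the outer door contains the absolute minimum [e l] of the order [l], so only the
    order [i0] can bound the points off the door; the added point must be the [r i0]-largest of
    them. *)
Lemma card_outer_extensions (x0 : V) i0 : x0 \notin e @: [set~ i0] ->
  #|[set x in ~: (e @: [set~ i0]) | dominant r (x |: e @: [set~ i0])]| = 1.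
Proof.
set D := e @: _ => x0D.
pose a := [arg max_(x > x0 | x \notin D) r i0 x].
have [aD amax] : a \notin D /\ forall x, x \notin D -> r i0 x <= r i0 a.
  by rewrite /a; case: arg_maxnP.
suff -> : [set x in ~: D | dominant r (x |: D)] = [set a] by rewrite cards1.
apply/setP => x; rewrite !inE; apply/andP/eqP => [[xD /dominantP dx]|->].
  apply: (@r_inj i0); apply/anti_leq; rewrite amax //=.
  have [l hl] := dx a.
  have [li|li] := eqVneq l i0; first by rewrite -li hl // !inE eqxx.
  have elD : e l \in D by rewrite imset_f // !inE.
  have al : a = e l.
    by apply: (@r_inj l); apply/anti_leq; rewrite e_min hl // !inE elD orbT.
  by rewrite al elD in aD.
split=> //; apply/dominantP => y.
have [/imsetP[j _ ->]|yD] := boolP (y \in D); first by exists j.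
exists i0 => z /setU1P[->|/imsetP[j]]; first exact: amax.
rewrite !inE => ji ->.
have [ye|] := boolP [forall k, y != e k].
  by apply: ltnW; apply: e_max => //; exact/forallP.
rewrite negb_forall => /existsP[k]; rewrite negbK => /eqP yk.
have [<-|ki] := eqVneq k i0; first by rewrite yk.
by rewrite yk imset_f // !inE in yD.
Qed.

(* Sperner's parity argument: doors are the sets D of #|N|-1 points coloured
   by all colours but i0, rooms the dominant sets of #|N| points.  Every door
   lies in 0 or 2 rooms, except for the outer one, which lies in exactly one;
   a room contains 0 or 2 doors unless it has all colours. *)
Theorem scarf_dominant_colorful (i0 : N) : exists2 S, dominant r S & c @: S = setT.
Proof.
have [/existsP[S /andP[dS /eqP cS]]|] :=
  boolP [exists S : {set V}, dominant r S && (c @: S == setT)].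
  by exists S.
rewrite negb_exists => /forallP noS; exfalso.
pose D0 := e @: [set~ i0].
have e_inj : injective e by apply: can_inj ce.
pose door D := (c @: D == [set~ i0]) && (#|D|.+1 == #|N|).
pose room D x := [&& x \notin D, door D & dominant r (x |: D)].
have doorE D : door D ->
    \sum_(x | room D x) 1 = #|[set x in ~: D | dominant r (x |: D)]|.
  by move=> dD; rewrite sum1dep_card; apply: eq_card => x; rewrite !inE /room dD.
have dD0 : door D0.
  rewrite /door -imset_comp (eq_imset _ ce) imset_id eqxx.
  by rewrite card_imset // cardsC1 (cardD1 i0) !inE eqxx.
have : odd (\sum_D \sum_(x | room D x) 1).
  rewrite (bigD1 D0) //= oddD doorE // (@card_outer_extensions (e i0)); last first.
    by apply/imsetP => -[j /[!inE] ji /e_inj E]; rewrite E eqxx in ji.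
  rewrite /=; apply: (big_ind (fun k => ~~ odd k)) => //.
    by move=> p q hp hq; rewrite oddD (negbTE hp).
  move=> D DD0; have [dD|ndD] := boolP (door D); last first.
    by rewrite big1 // => x /and3P[_ dD]; rewrite dD in ndD.
  rewrite doorE //; case/andP: dD => /eqP cD /eqP cardD.
  exact: card_extensions_even cD cardD DD0.
apply/negP.
pose roomS S x := [&& dominant r S, #|S| == #|N|, x \in S
                    & c @: (S :\ x) == [set~ i0]].
(* The same pairs counted by rooms: [(D, x)] corresponds to [(x |: D, x)]. *)
have -> : \sum_D \sum_(x | room D x) 1 = \sum_S \sum_(x | roomS S x) 1.
  rewrite !pair_big_dep /=.
  rewrite (reindex_onto (fun p : {set V} * V => (p.1 :\ p.2, p.2))
     (fun p => (p.2 |: p.1, p.2))) /=; last first.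
    by case=> D x /= /andP[xD _]; rewrite setU1K.
  apply: eq_bigl => -[S x] /=; rewrite /room /roomS /door /= setD11 /=.
  rewrite xpair_eqE eqxx andbT.
  have [xS|xS] := boolP (x \in S); last first.
    rewrite !andbF; apply/negbTE/negP => /andP[_ /eqP E].
    by rewrite -E !inE eqxx in xS.
  rewrite setD1K // eqxx andbT /= (cardsD1 x S) xS /= add1n.
  by rewrite -andbA andbC -andbA andbC -andbA; do 2![case: (_ == _) => //=]; rewrite ?andbT.
apply: (big_ind (fun k => ~~ odd k)) => //.
  by move=> p q hp hq; rewrite oddD (negbTE hp).
move=> S _; have [/andP[dS /eqP cS]|h] := boolP (dominant r S && (#|S| == #|N|)).
  have := noS S; rewrite dS /= => cSN; have := card_removals_even i0 cS cSN.
  congr (~~ odd _); rewrite sum1dep_card; apply: eq_card => x.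
  by rewrite !inE /roomS dS cS eqxx.
by rewrite big1 // => x /and4P[h1 h2]; rewrite h1 h2 in h.
Qed.
End Scarf.

(** * Grids on the simplex *)

Definition grid n m := {x : {ffun 'I_n.+1 -> 'I_m.+1} | \sum_i x i == m}.

Lemma grid_above n m (g : 'I_n.+1 -> nat) : \sum_i g i <= m ->
  exists x : grid n m, forall i, g i <= val x i.
Proof.
(* The missing mass goes to the coordinate 0. *)
move=> gm; pose h i := g i + (i == ord0) * (m - \sum_i g i).
have hm i : h i < m.+1.
  have : g i <= \sum_i g i by rewrite (bigD1 i) //= leq_addr.
  by rewrite /h; case: (i == ord0); lia.
have hsum : \sum_i [ffun i => inord (h i) : 'I_m.+1] i == m.
  under eq_bigr do rewrite ffunE inordK //.
  rewrite big_split /= -big_distrl /= [X in X * _](bigD1 ord0) //=.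
  rewrite [X in (_ + X) * _]big1 ?mul1n.
    by rewrite subnKC.
  by move=> i /negbTE->.
pose G := {ffun 'I_n.+1 -> 'I_m.+1}.
exists (exist (fun x : G => \sum_i x i == m) [ffun i => inord (h i)] hsum) => i.
by rewrite /= ffunE inordK // leq_addr.
Qed.

(* Scarf's lemma for the orders "compare the [i]-th coordinates", with ties
   broken by enumeration; the artificial points [inr i] stand for the facets. *)
Lemma grid_coloring n m (col : grid n m -> 'I_n.+1) :
  exists y : grid n m, forall i, val y i < n.+1 \/
    exists2 y' : grid n m, col y' = i &
      forall k, val y k < val y' k + n.+1 /\ val y' k < val y k + n.+1.
Proof.
pose V : finType := (grid n m + 'I_n.+1)%type.
(* The shift by one reserves the key 0 for [inr i] in its own order; [m.+2] exceeds every shifted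
   coordinate. *)
pose key (i : 'I_n.+1) (v : V) := match v with
  | inl x => (val x i).+1 | inr j => if i == j then 0 else m.+2 end.
pose r (i : 'I_n.+1) (v : V) := key i v * #|V| + enum_rank v.
have r_key i v w : r i v <= r i w -> key i v <= key i w.
  apply: contraTT; rewrite -!ltnNge => kwv.
  rewrite /r; apply: (@leq_trans ((key i w).+1 * #|V|)).
    by rewrite mulSn addnC ltn_add2r.
  by rewrite (leq_trans (leq_mul kwv (leqnn _))) ?leq_addr.
have key_r i v w : key i v < key i w -> r i v < r i w.
  by move=> kvw; rewrite ltnNge; apply: contraL kvw => /r_key; rewrite -leqNgt.
pose c (v : V) := match v with inl x => col x | inr j => j end.
have [||||S /dominantP domS cS] := @scarf_dominant_colorful V _ r inr c _ _ _ _ ord0.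
- move=> i v w; rewrite /r => /(congr1 (modn^~ #|V|)).
  by rewrite !modnMDl !modn_small // => /ord_inj/enum_rank_inj.
- move=> i x; have [->//|xi] := eqVneq x (inr i).
  apply/ltnW/key_r; rewrite /key /= eqxx.
  by case: x xi => //= j; have [->|//] := eqVneq i j; rewrite eqxx.
- move=> i j x xe ji; apply: key_r; rewrite /key eq_sym (negbTE ji).
  by case: x xe => [x _|k /(_ k)/eqP//]; rewrite ltnS ltn_ord.
- by [].
(* Only orders whose artificial point is outside [S] can bound a grid point, since [inr i] is least
   in the order [i]; their colours must occur at grid points of [S]. *)
pose C (i : 'I_n.+1) := inr i \notin S.
have domX (x : grid n m) : exists2 i, C i &
    forall y : grid n m, inl y \in S -> val x i <= val y i.
  have [i hi] := domS (inl x); exists i.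
    by apply/negP => /hi/r_key; rewrite /= eqxx.
  by move=> y /hi/r_key.
have colS i : C i -> exists2 y : grid n m, inl y \in S & col y = i.
  move=> Ci; have : i \in c @: S by rewrite cS inE.
  case/imsetP=> -[y yS ->|j jS ij]; first by exists y.
  by case/negP: Ci; rewrite ij.
have [x0 _] : exists x : grid n m, forall i : 'I_n.+1, 0 <= val x i.
  by apply: (@grid_above n m (fun=> 0)); rewrite big1.
have [i0 Ci0 _] := domX x0; have [y0 y0S _] := colS i0 Ci0.
pose mu (i : 'I_n.+1) : nat := if C i then
  val (val [arg min_(y < y0 | inl y \in S) val (val y i)] i) else 0.
have mu_le i (y : grid n m) : inl y \in S -> mu i <= val y i.
  by move=> yS; rewrite /mu; case: (C i) => //; case: arg_minnP => // z _; apply.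
(* A grid point with coordinates at least [mu i + C i] would exceed, for every [i] in [C], the least
   [i]-th coordinate in [S], against dominance. Hence the sum of the [mu i] falls short of [m] by
   less than [n.+1], and every grid point of [S], having sum [m], stays within [n.+1] of [mu]. *)
have sum_mu : m < \sum_i (mu i + C i).
  rewrite ltnNge; apply/negP => /grid_above[x hx].
  have [i Ci hi] := domX x; have := hx i; rewrite Ci /mu Ci.
  by case: arg_minnP => // z zS _; rewrite /= addn1 ltnNge hi.
have near (y : grid n m) (k : 'I_n.+1) : inl y \in S -> val y k < mu k + n.+1.
  move=> yS; have := leq_ltn_trans (eq_leq (eqP (valP y))) sum_mu.
  rewrite big_split /= (bigD1 k) //= [X in _ < X + _ -> _](bigD1 k) //=.
  have : \sum_(i < n.+1 | i != k) mu i <= \sum_(i < n.+1 | i != k) sval y i.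
    by apply: leq_sum => i _; exact: mu_le.
  have : \sum_(i < n.+1) C i <= n.+1.
    by rewrite -[X in _ <= X](card_ord n.+1) -sum1_card leq_sum // => i; case: (C i).
  suff arith (p q s t u v : nat) : p <= v -> q <= s -> t + s < u + q + p ->
    t < u + v by exact: arith.
  by lia.
exists y0 => i; have [Ci|nCi] := boolP (C i); last first.
  by left; have := near y0 i y0S; rewrite /mu (negbTE nCi).
right; have [y yS yi] := colS i Ci; exists y => // k.
by split; apply: leq_trans (near _ k _) _ => //; rewrite leq_add2r mu_le.
Qed.

From mathcomp Require Import all_order all_algebra sesquilinear.
From mathcomp Require Import all_classical all_reals all_analysis ring lra.

Import Order.TTheory GRing.Theory Num.Theory.
Import numFieldNormedType.Exports.

Local Open Scope classical_set_scope.
Local Open Scope ring_scope.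

(** * The Knaster-Kuratowski-Mazurkiewicz lemma *)

Section Simplex.
Context (R : realType) (n : nat).
Implicit Types x y : 'rV[R]_n.+1.

Definition simplex : set 'rV[R]_n.+1 :=
  [set x | (forall i, 0 <= x ord0 i) /\ \sum_i x ord0 i = 1].

Lemma continuous_coord i : continuous (fun x => x ord0 i).
Proof. exact: coord_continuous. Qed.

Lemma continuous_sumR (T : topologicalType) (F : 'I_n.+1 -> T -> R) :
  (forall i, continuous (F i)) -> continuous (fun t => \sum_i F i t).
Proof.
move=> cF; apply: (@continuous_big _ _ +%R 0 xpredT) => // z.
exact: add_continuous.
Qed.

Lemma simplex_le1 x i : simplex x -> x ord0 i <= 1.
Proof.
by move=> [x0 <-]; rewrite (bigD1 i) //= lerDl sumr_ge0.
Qed.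

Lemma simplex_compact : compact simplex.
Proof.
have cc : compact [set x : 'rV[R]_n.+1 | forall i, `[0 : R, 1]%classic (x ord0 i)].
  by apply: (@rV_compact R n.+1 (fun=> `[0 : R, 1]%classic)) => i; exact: segment_compact.
apply: (subclosed_compact _ cc) => [|x Dx i]; last first.
  by rewrite /= in_itv /= simplex_le1 // andbT; exact: Dx.1.
have -> : simplex = (\bigcap_i [set x | 0 <= x ord0 i]) `&`
    [set x | \sum_i x ord0 i = 1].
  by apply/seteqP; split=> x [h1 h2]; split=> // i; [move=> _|]; exact: h1.
apply: closedI.
  apply: closed_bigI => i _.
  by have /continuous_closedP/(_ _ (@closed_ge R 0)) := @continuous_coord i.
have := continuous_sumR continuous_coord.
by move=> /continuous_closedP/(_ _ (@closed_eq R 1)).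
Qed.

Lemma rV_norm_le x (e : R) : 0 <= e -> (forall i, `|x ord0 i| <= e) -> `|x| <= e.
Proof.
move=> e0 h; rewrite /Num.norm /= mx_normrE; apply/bigmax_leP; split=> //.
by case=> i j _ /=; rewrite ord1.
Qed.

Lemma rV_coord_le x i : `|x ord0 i| <= `|x|.
Proof.
by rewrite [leRHS]/Num.norm /= mx_normrE; apply/bigmax_geP; right; exists (ord0, i).
Qed.

Definition grid_point m (y : grid n m.+1) : 'rV[R]_n.+1 :=
  \row_i ((val y i)%:R / m.+1%:R).

Lemma grid_point_simplex m (y : grid n m.+1) : simplex (grid_point y).
Proof.
split=> [i|]; first by rewrite mxE divr_ge0.
under eq_bigr do rewrite mxE.
by rewrite -mulr_suml -natr_sum (eqP (valP y)) divff // pnatr_eq0.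
Qed.

(** Colour a grid point [y] by an index [i] with [0 <= h i y]. [grid_coloring] gives a grid point
    where every [h i] is at least [- (L * (n.+1 / m.+1))]: by the bound near the facet if the [i]-th
    coordinate is small, by the Lipschitz bound if a point of colour [i] is near. The negative parts
    thus become arbitrarily small together, and by compactness they vanish somewhere. *)
Lemma simplex_coloring (h : 'I_n.+1 -> 'rV[R]_n.+1 -> R) (L : R) : 0 <= L ->
    (forall i, continuous (h i)) ->
    (forall i x y, simplex x -> simplex y -> `|h i x - h i y| <= L * `|x - y|) ->
    (forall i x, simplex x -> - (L * x ord0 i) <= h i x) ->
    (forall x, simplex x -> exists i, 0 <= h i x) ->
  exists2 x, simplex x & forall i, 0 <= h i x.
Proof.
move=> L0 ch lip bd hex.
(* [F] is twice the sum of the negative parts. *)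
pose F x := \sum_i (`|h i x| - h i x).
have t_ge0 i x : 0 <= `|h i x| - h i x by rewrite subr_ge0 ler_norm.
have cF : continuous F.
  apply: continuous_sumR => i x.
  exact: cvgB (cvg_norm (ch i x)) (ch i x).
have D0 : simplex !=set0.
  (* [grid_coloring] serves here only to produce a grid point. *)
  have [y _] := @grid_coloring n 1 (fun=> ord0).
  by exists (grid_point y); exact: grid_point_simplex.
have [x /set_mem Dx xmin] :=
  compact_EVT_min D0 simplex_compact (continuous_subspaceT cF).
exists x => // i; rewrite leNgt; apply/negP => hi.
have Fx : 0 < F x.
  rewrite /F (bigD1 i) //= ltr_wpDr ?sumr_ge0 //.
  by rewrite subr_gt0 (lt_le_trans hi).
pose c : R := \sum_(i < n.+1) (2 * (L * n.+1%:R)).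
have Fm m : F x <= c / m.+1%:R.
  have col (y : grid n m.+1) := cid (hex _ (grid_point_simplex y)).
  have [y hy] := @grid_coloring n m.+1 (fun z => sval (col z)).
  apply: (le_trans (xmin (grid_point y) _)).
    by rewrite inE; exact: grid_point_simplex.
  rewrite mulr_suml; apply: ler_sum => j _.
  suff hge : - (L * (n.+1%:R / m.+1%:R)) <= h j (grid_point y).
    have r0 : 0 <= L * (n.+1%:R / m.+1%:R) by rewrite mulr_ge0 // divr_ge0.
    rewrite -!mulrA; move: (L * _) r0 hge => r r0 hge.
    by have [h0|h0] := ger0P (h j (grid_point y)); lra.
  have [yj|[y' y'j yy']] := hy j.
    apply: le_trans (bd j _ (grid_point_simplex y)).
    rewrite lerN2 ler_wpM2l // mxE ler_pM2r ?invr_gt0 ?ltr0n // ler_nat.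
    exact: ltnW.
  have h0 : 0 <= h j (grid_point y').
    by rewrite -y'j; exact: (svalP (col y')).
  have := lip j _ _ (grid_point_simplex y') (grid_point_simplex y).
  suff : `|grid_point y' - grid_point y| <= n.+1%:R / m.+1%:R.
    move=> /(ler_wpM2l L0) h1 /le_trans/(_ h1); rewrite ler_norml => /andP[_].
    by move: (L * (n.+1%:R / _)) => e; lra.
  apply: rV_norm_le => [|k]; first by rewrite divr_ge0.
  rewrite !mxE -mulrBl normrM [X in _ * X]ger0_norm ?invr_ge0 //.
  rewrite ler_pM2r ?invr_gt0 ?ltr0n // ler_norml.
  have [/ltnW h1 /ltnW h2] := yy' k.
  move: h1 h2; rewrite -!(ler_nat R) !natrD => h1 h2; lra.
have c0 : 0 <= c by apply: sumr_ge0 => ? _; rewrite mulr_ge0 // mulr_ge0.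
(* This grid is fine enough for [c / m.+1 < F x]. *)
have := Fm (Num.trunc (c / F x)); apply/negP; rewrite -ltNge.
rewrite ltr_pdivrMr ?ltr0n // mulrC -ltr_pdivrMr //.
exact: truncnS_gt.
Qed.

(* The cap 1 is the value of the distance to the empty set. *)
Definition capped_dist (C : set 'rV[R]_n.+1) x : R :=
  inf ([set 1] `|` [set `|x - y| | y in C]).

Let dist_has_lb C x : has_lbound ([set 1] `|` [set `|x - y| | y in C]).
Proof. by exists 0 => _ [->|[y _ <-]]. Qed.

Lemma capped_dist_ge0 C x : 0 <= capped_dist C x.
Proof.
by apply: lb_le_inf => [|_ [->|[y _ <-]]]//; exists 1; left.
Qed.

Lemma capped_dist_le1 C x : capped_dist C x <= 1.
Proof. by apply: ge_inf => //; left. Qed.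

Lemma capped_dist_leD C x y : capped_dist C x <= capped_dist C y + `|x - y|.
Proof.
rewrite -lerBlDr; apply: lb_le_inf; first by exists 1; left.
move=> _ [->|[z Cz <-]]; rewrite lerBlDr.
  by rewrite (le_trans (capped_dist_le1 _ _)) // lerDl.
apply: (@le_trans _ _ `|x - z|); first by apply: ge_inf => //; right; exists z.
by rewrite [leRHS]addrC -(subrKA y) ler_normD.
Qed.

Lemma capped_dist_lip C x y : `|capped_dist C x - capped_dist C y| <= `|x - y|.
Proof.
have := capped_dist_leD C x y; have := capped_dist_leD C y x.
by rewrite distrC ler_norml => h1 h2; lra.
Qed.

Lemma capped_dist_continuous C : continuous (capped_dist C).
Proof.
move=> x; apply/(@cvgrPdist_lt R R^o _ (nbhs x)) => e e0; near=> y.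
apply: (le_lt_trans (capped_dist_lip _ _ _)); near: y.
exact: nbhs_ball_norm (PosNum e0).
Unshelve. all: by end_near. Qed.

Lemma capped_dist_in C x : C x -> capped_dist C x = 0.
Proof.
move=> Cx; apply/eqP; rewrite eq_le capped_dist_ge0 andbT.
by apply: ge_inf => //; right; exists x; rewrite // subrr normr0.
Qed.

Lemma capped_dist_eq0 C x : closed C -> capped_dist C x = 0 -> C x.
Proof.
move=> cC d0; apply: cC => U /nbhs_ballP[e /= e0 eU].
(* A bound of at most 1 rules out the cap, so the element found is a true distance. *)
have m0 : 0 < Num.min e 1 by rewrite lt_min e0 ltr01.
have [|z hz] := @inf_adherent _ ([set 1] `|` [set `|x - y| | y in C]) _ m0.
  by split=> //; exists 1; left.
rewrite -/(capped_dist C x) d0 add0r lt_min => /andP[ze z1].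
case: hz => [z1E|[y Cy yz]]; first by rewrite z1E ltxx in z1.
by exists y; split=> //; apply: eU; rewrite -ball_normE /= yz.
Qed.

(* With [d i] the capped distance to [C i], apply [simplex_coloring] to
   [h i x = d i x - x_i * \sum_j d j x]: it gives [x] with
   [d i x = x_i * \sum_j d j x] for all [i] (a Brouwer fixed point of
   [d / \sum d]); the covering hypothesis then forces [d = 0]. *)
Theorem kkm (C : 'I_n.+1 -> set 'rV[R]_n.+1) :
    (forall i, closed (C i)) ->
    (forall x, simplex x -> exists2 i, 0 < x ord0 i & C i x) ->
  exists2 x, simplex x & forall i, C i x.
Proof.
move=> cC cov.
pose d i := capped_dist (C i); pose S x := \sum_i d i x.
pose h i x := d i x - x ord0 i * S x.
(* The summand 1 is the Lipschitz constant of [d i]; one [n.+1] comes from the bound on [S], the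
   other from its Lipschitz constant. *)
pose L : R := 1 + (n.+1%:R + n.+1%:R).
have S0 x : 0 <= S x by apply: sumr_ge0 => i _; exact: capped_dist_ge0.
have nE : n.+1%:R = \sum_(i < n.+1) 1 :> R by rewrite sumr_const card_ord.
have Sn x : S x <= n.+1%:R.
  by rewrite nE; apply: ler_sum => i _; exact: capped_dist_le1.
have Slip x y : `|S x - S y| <= n.+1%:R * `|x - y|.
  rewrite /S -sumrB (le_trans (ler_norm_sum _ _ _)) //.
  rewrite nE mulr_suml.
  by apply: ler_sum => i _; rewrite mul1r; exact: capped_dist_lip.
have cS : continuous S by apply: continuous_sumR => i; exact: capped_dist_continuous.
have n1 : 1 <= n.+1%:R :> R by rewrite ler1n.
have sumh x : simplex x -> \sum_i h i x = 0.
  by move=> [_ x1]; rewrite sumrB -mulr_suml x1 mul1r subrr.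
have [|||||x Dx hx] := @simplex_coloring h L.
- by rewrite addr_ge0 // addr_ge0.
- move=> i x; apply: cvgB (cvgM (@continuous_coord i x) (cS x)).
  exact: (@capped_dist_continuous (C i) x).
- move=> i x y Dx Dy.
  have -> : h i x - h i y = (d i x - d i y) -
      ((x ord0 i - y ord0 i) * S x + y ord0 i * (S x - S y)).
    by rewrite /h; ring.
  have -> : L * `|x - y| =
      `|x - y| + (n.+1%:R * `|x - y| + n.+1%:R * `|x - y|) by rewrite /L; ring.
  apply: (le_trans (ler_normB _ _)); apply: lerD; first exact: capped_dist_lip.
  apply: (le_trans (ler_normD _ _)); rewrite !normrM; apply: lerD.
    rewrite mulrC [`|S x|]ger0_norm //; apply: ler_pM => //.
    by have := rV_coord_le (x - y) i; rewrite !mxE.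
  apply: le_trans (Slip x y); rewrite ler_piMl // ger0_norm ?simplex_le1 //.
  exact: Dy.1.
- move=> i x Dx; have xS : x ord0 i * S x <= L * x ord0 i.
    rewrite [leRHS]mulrC ler_wpM2l //; first exact: Dx.1.
    by rewrite (le_trans (Sn x)) // /L; move: n1; lra.
  by have := capped_dist_ge0 (C i) x; rewrite /h /d; move: xS; lra.
(* The [h i x] sum to 0, so they are not all negative. *)
- move=> x Dx; apply: contrapT => /forallNP hn.
  have := sumh x Dx; apply/eqP; rewrite lt_eqF // (bigD1 ord0) //=.
  rewrite ltr_nwDl //; first by rewrite ltNge; apply/negP/hn.
  by apply: sumr_le0 => i _; rewrite ltW // ltNge; apply/negP/hn.
have h0 i : h i x = 0.
  have /eqP := sumh x Dx; rewrite psumr_eq0 // => /allP/(_ i).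
  by rewrite mem_index_enum => /(_ isT)/eqP.
have dE i : d i x = x ord0 i * S x by apply/eqP; rewrite -subr_eq0; exact/eqP/h0.
have [i xi Ci] := cov x Dx.
have Sx : S x = 0.
  have := dE i; rewrite /d capped_dist_in // => /esym/eqP.
  by rewrite mulf_eq0 (gt_eqF xi) => /eqP.
exists x => // j; apply: capped_dist_eq0 => //.
by have := dE j; rewrite Sx mulr0.
Qed.

End Simplex.

(** * Closed superlevel sets and convex combinations *)

Lemma usc_closed_ge (R : realType) (S : topologicalType) (g : S -> R) (r : R) :
  upper_semicontinuous g -> closed [set x | r <= g x].
Proof.
move=> uscg x0 clx0.
(* The net runs over the neighbourhoods of [x0], ordered by reverse inclusion, with a point of the
   set picked in each; its values are at least [r], hence so is its limsup. *)
pose I := {U : set S | nbhs x0 U}.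
pose le (U V : I) := sval V `<=` sval U.
have pick (U : I) := cid (clx0 _ (svalP U)).
have dir : directed_rel le.
  split=> [|U|U V W UV VW|U V].
  - by constructor; exists setT; exact: filterT.
  - exact: subset_refl.
  - exact: subset_trans VW UV.
  - have UV : nbhs x0 (sval U `&` sval V).
      apply: filterI; [exact: (svalP U)|exact: (svalP V)].
    by exists (exist _ _ UV) => x [].
have cvg : net_cvg le (fun U => sval (pick U)) x0.
  move=> U U0; exists (exist _ U U0) => V UV.
  by apply: UV; case: (svalP (pick V)).
rewrite /= -lee_fin; apply: le_trans (uscg _ _ _ _ dir cvg).
apply: le_ereal_inf_tmp => _ [U _ <-].
apply: (@le_trans _ _ (g (sval (pick U)))%:E).
  by rewrite lee_fin; case: (svalP (pick U)).
by apply: ereal_sup_ubound; exists U => //; case: dir.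
Qed.

(** Induction: the points after the first are combined with their weights divided by [1 - s]; when
    [s = 1] these weights are all zero. *)
Lemma convex_set_sum (R : realType) (X : lmodType R) (K : set X) n
    (a : 'I_n.+1 -> R) (u : 'I_n.+1 -> X) :
    convex_set K -> (forall i, 0 <= a i) -> \sum_i a i = 1 ->
  (forall i, K (u i)) -> K (\sum_i a i *: u i).
Proof.
move=> cK; elim: n a u => [|n IHn] a u a0 a1 Ku.
  by move: a1; rewrite !big_ord1 => ->; rewrite scale1r.
rewrite big_ord_recl; set s := a ord0.
have s1 : \sum_(i < n.+1) a (lift ord0 i) = 1 - s.
  by move: a1; rewrite big_ord_recl -/s => <-; rewrite [s + _]addrC addrK.
have s0 : 0 <= 1 - s by rewrite -s1 sumr_ge0.
have [s1E|sN1] := eqVneq (1 - s) 0.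
  have z i : a (lift ord0 i) = 0.
    have /eqP := s1; rewrite s1E psumr_eq0 // => /allP/(_ i).
    by rewrite mem_index_enum => /(_ isT)/eqP.
  have -> : s = 1 by apply/eqP; rewrite eq_sym -subr_eq0 s1E.
  by rewrite scale1r big1 ?addr0 // => i _; rewrite z scale0r.
have sl1 : s <= 1 by rewrite -subr_ge0.
pose v := \sum_(i < n.+1) (a (lift ord0 i) / (1 - s)) *: u (lift ord0 i).
have Kv : K v.
  apply: IHn => [i||i]; [by rewrite divr_ge0| |exact: Ku].
  by rewrite -mulr_suml s1 divff.
have := cK (u ord0) v (Itv01 (a0 ord0) sl1).
rewrite !inE => /(_ (Ku _) Kv).
congr K; rewrite /conv /=; congr (_ + _).
rewrite scaler_sumr; apply: eq_bigr => i _.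
by rewrite scalerA mulrC divfK.
Qed.

(** * Monotonically related points *)

Section Minty.
Context (R : realType) (X Y : lmodType R).
Context (c : {bilinear X -> Y -> R | *%R & *%R}).

Lemma couplingB (p q : X * Y) : coupling c (p - q) =
  c p.1 p.2 - c p.1 q.2 - (c q.1 p.2 - c q.1 q.2).
Proof. by rewrite /coupling /= linearBl !linearBr. Qed.

(** The terms in [w] cancel because [x] is the barycenter of the first components, so [w] may be
    arbitrary. What remains is half the double sum of the nonnegative
    [a i * a j * coupling c (z i - z j)]. *)
Lemma monotone_barycenter n (a : 'I_n -> R) (z : 'I_n -> X * Y) (w : Y) :
    (forall i, 0 <= a i) -> \sum_i a i = 1 ->
    (forall i j, 0 <= coupling c (z i - z j)) ->
  0 <= \sum_i a i * coupling c (z i - (\sum_j a j *: (z j).1, w)).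
Proof.
move=> a0 a1 mon; set x := \sum_j (_ *: _).
pose b i j := c (z i).1 (z j).2.
have bE i : c x (z i).2 = \sum_j a j * b j i.
  by rewrite /x linear_sumlz; apply: eq_bigr => j _; rewrite linearZl_LR.
have xw : c x w = \sum_i a i * c (z i).1 w.
  by rewrite /x linear_sumlz; apply: eq_bigr => j _; rewrite linearZl_LR.
have -> : \sum_i a i * coupling c (z i - (x, w)) =
    \sum_i a i * b i i - \sum_i \sum_j a i * a j * b j i.
  have -> : \sum_i a i * coupling c (z i - (x, w)) =
      (\sum_i a i * b i i - \sum_i a i * c x (z i).2) -
      (\sum_i a i * c (z i).1 w - \sum_i a i * c x w).
    rewrite -!sumrB; apply: eq_bigr => i _.
    by rewrite couplingB /b /=; ring.
  rewrite -mulr_suml a1 mul1r -xw subrr subr0; congr (_ - _).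
  apply: eq_bigr => i _; rewrite bE mulr_sumr; apply: eq_bigr => j _.
  by rewrite mulrA.
have : 0 <= \sum_i \sum_j a i * a j * coupling c (z i - z j).
  by do 2![apply: sumr_ge0 => ? _]; rewrite mulr_ge0 // mulr_ge0.
have -> : \sum_i \sum_j a i * a j * coupling c (z i - z j) =
    (\sum_i \sum_j a j * (a i * b i i) + \sum_i \sum_j a i * (a j * b j j)) -
    (\sum_i \sum_j a j * a i * b i j + \sum_i \sum_j a i * a j * b j i).
  rewrite -!big_split -sumrB /=; apply: eq_bigr => i _.
  rewrite -!big_split -sumrB /=; apply: eq_bigr => j _.
  by rewrite couplingB /b /=; ring.
have -> : \sum_i \sum_j a j * (a i * b i i) = \sum_i a i * b i i.
  by apply: eq_bigr => i _; rewrite -mulr_suml a1 mul1r.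
have -> : \sum_i \sum_j a i * (a j * b j j) = \sum_i a i * b i i.
  rewrite exchange_big /=.
  by apply: eq_bigr => i _; rewrite -mulr_suml a1 mul1r.
have -> : \sum_i \sum_j a j * a i * b i j = \sum_i \sum_j a i * a j * b j i.
  by rewrite exchange_big.
by lra.
Qed.

Context (K : set X) (f : K -> Y) (beta : topology_on (lin_span K)).
Hypothesis K_convex : convex_set K.
Hypothesis beta_linear : is_linear_topology beta.

(** The values are taken in the span, where linearity of [beta] gives continuity; [barycenter_in]
    leads back to [K]. *)
Definition barycenter n (u : 'I_n.+1 -> K) (x : 'rV[R]_n.+1) :
  with_topology beta := \sum_i x ord0 i *: (to_lin (u i) : with_topology beta).

Lemma barycenter_continuous n (u : 'I_n.+1 -> K) : continuous (barycenter u).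
Proof.
apply: (@continuous_big _ _ +%R 0 xpredT) => [|i _ x]; first exact: beta_linear.1.
have cs := beta_linear.2 (x ord0 i, to_lin (u i)).
apply: (@continuous_comp _ _ _
  (fun x : 'rV[R]_n.+1 => (x ord0 i : R^o, to_lin (u i) : with_topology beta))
  (fun z => z.1 *: z.2)) => //.
exact: cvg_pair (@coord_continuous _ _ _ ord0 i x) (cvg_cst _).
Qed.

Lemma barycenter_val n (u : 'I_n.+1 -> K) x :
  lin_val (barycenter u x) = \sum_i x ord0 i *: val (u i).
Proof.
by rewrite /barycenter [LHS](raddf_sum (\val : lin_span K -> X)); apply: eq_bigr.
Qed.

Lemma barycenter_in n (u : 'I_n.+1 -> K) x : simplex x ->
  exists k : K, to_lin k = barycenter u x.
Proof.
move=> [x0 x1].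
have Kb : K (lin_val (barycenter u x)).
  by rewrite barycenter_val; apply: convex_set_sum => // i; exact: set_valP.
exists (SigSub (mem_set Kb)); exact: val_inj.
Qed.

Lemma finite_monotone_related n (z : 'I_n.+1 -> X * Y) :
    (forall i j, 0 <= coupling c (z i - z j)) -> (forall i, K (z i).1) ->
    (forall i, upper_semicontinuous
       (fun x : trace_topology beta => coupling c (z i - (val (x : K), f x)))) ->
  exists k : K, forall i, 0 <= coupling c (z i - (val k, f k)).
Proof.
move=> mon Kz usc.
(* KKM needs closed sets that can be pulled back along [barycenter], which maps to the span. So the
   open set of [K] where [g i] is negative is written as the trace of an open set [O i] of the
   span. *)
pose g i (k : K) := coupling c (z i - (val k, f k)).
pose u i : K := SigSub (mem_set (Kz i)).
have OP i : exists O : set (with_topology beta), open O /\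
    forall k, O (to_lin k) <-> ~ 0 <= g i k.
  have /closed_openC := @usc_closed_ge _ _ _ 0 (usc i).
  case=> O oO OE; exists O; split=> // k.
  by have /= -> := congr1 (fun A => A k) OE.
pose O i := sval (cid (OP i)).
have oO i : open (O i) := (svalP (cid (OP i))).1.
have OE i k : O i (to_lin k) <-> ~ 0 <= g i k := (svalP (cid (OP i))).2 k.
have [i||x Dx Cx] := @kkm R n (fun i => barycenter u @^-1` (~` O i)).
- have /continuous_closedP := @barycenter_continuous n u.
  by apply; exact: open_closedC.
- move=> x Dx; have [k kE] := barycenter_in u Dx.
  apply: contrapT => /forall2NP hn.
  have neg i : 0 < x ord0 i -> g i k < 0.
    move=> xi; have [//|/contrapT] := hn i.
    by rewrite /= -kE OE => /negP; rewrite -ltNge.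
  have [x0 x1] := Dx.
  have kx : val k = \sum_j x ord0 j *: (z j).1.
    by rewrite -(barycenter_val u) -kE.
  have := monotone_barycenter (f k) x0 x1 mon; rewrite -kx.
  apply/negP; rewrite -ltNge.
  have [i xi] : exists i, 0 < x ord0 i.
    apply: contrapT => /forallNP h; move: x1; rewrite big1 => [/esym/eqP|i _].
      by rewrite oner_eq0.
    by apply/eqP; rewrite eq_le x0 andbT leNgt; apply/negP.
  rewrite (bigD1 i) //= ltr_nwDl //; first by rewrite pmulr_rlt0 // neg.
  apply: sumr_le0 => j _; have := x0 j; rewrite le_eqVlt => /predU1P[<-|xj].
    by rewrite mul0r.
  by rewrite pmulr_rle0 // ltW // neg.
have [k kE] := barycenter_in u Dx.
by exists k => i; have := Cx i; rewrite /= -kE OE => /contrapT.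
Qed.

End Minty.

Theorem theorem25 (R : realType) (X Y : lmodType R)
  (c : {bilinear X -> Y -> R | *%R & *%R})
  (K : set X) (K_nonempty : K !=set0) (K_convex : convex_set K)
  (f : K -> Y)
  (T : X -> set Y) (T_monotone : op_monotone c T)
  (T_nonempty : op_graph T !=set0) (dom_T : op_dom T `<=` K)
  (beta : topology_on (lin_span K))
  (beta_linear : is_linear_topology beta)
  (beta_hausdorff : hausdorff_space (with_topology beta))
  (K_compact : compact [set: trace_topology beta])
  (fz_usc : forall z, op_graph T z ->
     upper_semicontinuous
       (fun x : trace_topology beta => coupling c (z - (val (x : K), f x)))) :
  (op_graph (op_polar c T) `&` fun_graph f) !=set0 /\
  exists x : K, op_polar c T (val x) (f x).
Proof.
(* [coupling] is even, which reconciles the opposite differences in [op_polar] and [fz_usc]. *)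
have opp z w : coupling c (z - w) = coupling c (w - z).
  by rewrite !couplingB; ring.
suff [x xP] : exists x : K, op_polar c T (val x) (f x).
  by split; exists (val x, f x) || exists x; rewrite //=; split=> //; exists x.
pose F z := [set x : trace_topology beta |
  0 <= coupling c (z - (val (x : K), f x))].
have finF : finI (op_graph T) F.
  move=> D DT; have [z0 Tz0] := T_nonempty.
  pose s : seq (X * Y) := finmap.enum_fset D.
  (* Prepending [z0] makes the family nonempty even if [D] is empty. *)
  pose z (i : 'I_(size s).+1) := nth z0 (z0 :: s) i.
  have Tz i : op_graph T (z i).
    have : z i \in z0 :: s by exact: mem_nth.
    by rewrite inE => /predU1P[->//|/DT/set_mem].
  have [|i|i|k hk] := @finite_monotone_related _ _ _ c K f beta K_convex beta_linear _ z.
  - by move=> i j; exact: T_monotone.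
  - by apply: dom_T; exists (z i).2; exact: Tz.
  - exact: fz_usc.
  exists k => w /= wD; have wz : w \in z0 :: s by rewrite inE wD orbT.
  have wi : (index w (z0 :: s) < (size s).+1)%N by rewrite -index_mem in wz.
  by have := hk (Ordinal wi); rewrite /z /= nth_index.
(* The sets [F z] generate a proper filter; its cluster point [p] lies in every [F w], as these are
   closed. *)
have [|p [_ clp]] := K_compact _ (finI_filter finF).
  have [z0 Tz0] := T_nonempty; exists (F z0) => //; exact: finI_from1.
exists p => w Tw; rewrite opp.
apply: (@usc_closed_ge _ _ _ 0 (fz_usc w Tw)) => U pU.
apply: clp pU; exists (F w) => //; exact: finI_from1.
Qed.
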